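(* There exists an infeasible instance of size $23$.
   Context: Fix a palette of six distinct colors. A (colored) cube is a unit cube each of whose six faces is painted with exactly one color of the palette, all six faces receiving different colors. Two colored cubes have the same variety if one can be rotated onto the other; there are exactly 30 varieties. An instance is a finite multiset of colored cubes (several cubes of the same variety are allowed); its size is the number of cubes counted with multiplicity. A solid is a $2\times2\times2$ cube assembled from eight colored unit cubes such that each of its six outer $2\times2$ faces is of a single color and the six outer faces have six different colors; its variety is defined as for unit cubes. A solid of variety $v$ is composable from an instance $I$ if some eight cubes of $I$ can be placed and oriented to form a solid of variety $v$. An instance is infeasible if no solid of any variety is composable from it. *)

(* Defs.v *)
From HB Require Import structures.
From mathcomp Require Import all_boot all_order all_fingroup all_algebra.
From mathcomp Require Import finmap multiset.

Set Implicit Arguments.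
Unset Strict Implicit.
Unset Printing Implicit Defensive.

Import GRing.Theory.
Local Open Scope ring_scope.
Local Open Scope mset_scope.

(* The face (i, b) is the one whose outward normal is (-1) ^+ b times the i-th
   basis vector. *)
Definition face : finType := ('I_3 * bool)%type.

Definition color : finType := 'I_6.

(* There are six faces and six colors, so an injective coloring uses every
   color exactly once. *)
Definition cube : finType := {c : {ffun face -> color} | injectiveb c}.

Definition paint (c : cube) (f : face) : color := val c f.

(* The symmetries of the cube are the signed permutations (s, e), sending the
   j-th basis vector to (-1) ^+ e j times the (s j)-th one. *)
Definition symmetry : finType := ({perm 'I_3} * {ffun 'I_3 -> bool})%type.

Definition sym_mx (g : symmetry) : 'M[int]_3 :=
  \matrix_(i, j) (if i == g.1 j then (-1) ^+ g.2 j else 0).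

Definition sym_face (g : symmetry) (f : face) : face :=
  (g.1 f.1, f.2 (+) g.2 f.1).

Definition rotation (g : symmetry) : bool := \det (sym_mx g) == 1.

Definition same_variety (c d : cube) : bool :=
  [exists g, rotation g && [forall f, paint d (sym_face g f) == paint c f]].

Definition variety (c : cube) : {set cube} := [set d | same_variety c d].

Definition varieties : {set {set cube}} := [set variety c | c in [set: cube]].

(* The eight cells of the 2 x 2 x 2 arrangement: the cell p lies on side p i of
   each axis i, so its outer faces are the (i, p i). *)
Definition cell : finType := {ffun 'I_3 -> bool}.

(* The arrangement a, giving each cell its cube in its final orientation, is a
   solid whose six outer faces are painted as those of the cube s. *)
Definition solid (a : {ffun cell -> cube}) (s : cube) : Prop :=
  forall (p : cell) (i : 'I_3), paint (a p) (i, p i) = paint s (i, p i).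

(* The cube b p, taken from the instance, is put in the cell p with the
   orientation a p. *)
Definition composable (I : {mset cube}) (v : {set cube}) : Prop :=
  exists (b a : {ffun cell -> cube}) (s : cube),
    [/\ (seq_mset [seq b p | p : cell] `<=` I),
        forall p, same_variety (b p) (a p),
        solid a s
      & variety s = v].

Definition infeasible (I : {mset cube}) : Prop :=
  forall v, v \in varieties -> ~ composable I v.

(* Main.v *)
(* Up to rotation, a corner of a cube is a cyclically ordered triple of colors,
   and there are forty such triples. The eight corners of each of the five
   varieties of [stock] are pairwise disjoint, so a given corner is provided by
   at most one of these varieties. Taking three of them seven times and the
   other two once gives 7 + 7 + 7 + 1 + 1 = 23 cubes. Every solid asks one of
   the five varieties for more corners than it has copies: eight if the solid
   has one of the three frequent varieties, and at least two from one of the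
   two rare varieties otherwise. *)
Require Import Defs.
From mathcomp Require Import all_boot all_order all_fingroup all_algebra.
From mathcomp Require Import finmap multiset.
From mathcomp Require Import zify ring.

Set Implicit Arguments.
Unset Strict Implicit.
Unset Printing Implicit Defensive.

Import GRing.Theory.

(** Halving an index gives the axis of the face and its parity gives the sign, so opposite faces are
    adjacent entries of [code]. *)
Definition face_index (f : face) : nat := f.2 + (f.1 : nat).*2.

Definition code (c : cube) : seq nat :=
  mkseq (fun k => paint c (inord k./2, odd k) : nat) 6.

(** The images of the three positive axes under [h] are faces meeting at a vertex; when [h] is a
    rotation, they come in the cyclic order that rotations preserve. *)
Definition corner_faces (h : symmetry) : seq nat :=
  mkseq (fun j => face_index (h.1 (inord j), h.2 (inord j))) 3.

Definition corner (c : cube) (h : symmetry) : seq nat :=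
  [seq nth 0 (code c) k | k <- corner_faces h].

(* For three faces on distinct axes, the outward normals form a direct frame iff
   the number of inversions plus the number of negative normals is even; the
   parity of a face index tells the sign of its normal. *)
Definition positive (r : seq nat) : bool :=
  if r is [:: x; y; z] then ~~ odd (x + y + z + (y < x) + (z < x) + (z < y))
  else false.

Definition triples : seq (seq nat) :=
  [seq x :: r | x <- iota 0 6,
     r <- [seq [:: y; z] | y <- iota 0 6, z <- iota 0 6]].

(* Each corner is listed three times, once for each starting color. *)
Definition corners (l : seq nat) : seq (seq nat) :=
  [seq [seq nth 0 l k | k <- r]
     | r <- triples & uniq (map half r) && positive r].

Definition cell_faces (p : cell) : seq nat :=
  mkseq (fun i => face_index (inord i, p (inord i))) 3.

Definition rectify (r : seq nat) : seq nat :=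
  if positive r then r else [:: nth 0 r 1; nth 0 r 0; nth 0 r 2].

Definition cells : seq (seq nat) :=
  [seq x :: r | x <- [:: 0; 1],
     r <- [seq [:: y; z] | y <- [:: 2; 3], z <- [:: 4; 5]]].

(* Found by computer search. *)
Definition stock : seq (seq nat) :=
  nseq 7 [:: 0; 1; 2; 3; 4; 5] ++ nseq 7 [:: 0; 3; 1; 4; 5; 2] ++
  nseq 7 [:: 0; 4; 1; 2; 3; 5] ++
  [:: [:: 0; 2; 1; 5; 4; 3]; [:: 0; 5; 1; 3; 2; 4]].

(* Here [l] codes the solid and [w] the cube that provides its corners. *)
Definition supply (l w : seq nat) : nat :=
  let cs := corners w in
  count (fun r => [seq nth 0 l k | k <- rectify r] \in cs) cells.

(** All 720 colorings are tried, so no representatives of the varieties have to be chosen. *)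
Lemma stock_shortage :
  all (fun l => has (fun w => count_mem w stock < supply l w) (undup stock))
    (permutations (iota 0 6)).
Proof. by vm_compute. Qed.

Lemma corners_disjoint w1 w2 t : w1 \in stock -> w2 \in stock ->
  t \in corners w1 -> t \in corners w2 -> w1 = w2.
Proof.
have /allP stock_disj : all (fun w1 => all (fun w2 =>
  has (mem (corners w1)) (corners w2) ==> (w1 == w2)) stock) stock.
  by vm_compute.
move=> /stock_disj /allP disj1 /disj1 /implyP disj t1 t2; apply/eqP/disj.
by apply/hasP; exists t.
Qed.

Lemma det_mx33 (R : comPzRingType) (M : 'M[R]_3) :
  let m i j := M (inord i) (inord j) in
  (\det M = m 0 0 * (m 1 1 * m 2 2 - m 1 2 * m 2 1)
          - m 0 1 * (m 1 0 * m 2 2 - m 1 2 * m 2 0)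
          + m 0 2 * (m 1 0 * m 2 1 - m 1 1 * m 2 0))%R.
Proof.
move=> m; have mE i j : M i j = m i j by rewrite /m !inord_val.
rewrite (expand_det_row _ ord0) !big_ord_recl big_ord0 /cofactor.
rewrite !(expand_det_row _ ord0) !big_ord_recl !big_ord0 /cofactor !det_mx11.
rewrite !mxE !mE /=.
rewrite /bump /=; ring.
Qed.

Lemma cornerE c h :
  corner c h = mkseq (fun j => paint c (h.1 (inord j), h.2 (inord j)) : nat) 3.
Proof.
rewrite /corner /corner_faces -map_comp; apply: eq_map => j /=.
rewrite nth_mkseq /face_index /=; last first.
  by case: (h.1 _) (h.2 _) => k ? [] /=; lia.
by rewrite half_bit_double inord_val oddD odd_double addbF oddb.
Qed.

Lemma rotationE h :
  rotation h = uniq (map half (corner_faces h)) && positive (corner_faces h).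
Proof.
case: h => s e; rewrite /rotation det_mx33 !mxE /= /corner_faces /face_index /=.
rewrite !half_bit_double.
have s_neq i j : i < 3 -> j < 3 -> i != j -> s (inord i) != s (inord j).
  by move=> i3 j3; rewrite (inj_eq perm_inj) -val_eqE /= !inordK.
move: (s_neq 0 1 isT isT isT) (s_neq 0 2 isT isT isT) (s_neq 1 2 isT isT isT).
rewrite -!val_eqE /= !inordK //.
(* This leaves 48 concrete cases: three distinct axes and three signs. *)
move: (s _) (s _) (s _) (e _) (e _) (e _) => i j k a b c {s_neq}.
case: i j k => [[|[|[|//]]] ?] [[|[|[|//]]] ?] [[|[|[|//]]] ?] //;
  by case: a b c => [] [] [] _ _ _; vm_compute.
Qed.

(** This is [g] after [h]: a product of permutations applies its left factor first. *)
Definition compose (g h : symmetry) : symmetry :=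
  ((h.1 * g.1)%g, [ffun j => h.2 j (+) g.2 (h.1 j)]).

Lemma sym_mxM g h : sym_mx (compose g h) = (sym_mx g *m sym_mx h)%R.
Proof.
apply/matrixP => i j; rewrite !mxE (bigD1 (h.1 j)) //= big1 => [|k].
  rewrite !mxE eqxx permM ffunE addr0; case: ifP => _; last by rewrite mul0r.
  by rewrite signr_addb mulrC.
by rewrite !mxE => /negPf ->; rewrite mulr0.
Qed.

Lemma same_variety_corner c d h : same_variety c d -> rotation h ->
  exists2 h', rotation h' & corner c h' = corner d h.
Proof.
move=> /existsP[g /andP[rot_g /forallP paint_g]] rot_h.
(* The inverse of [g] after [h]: it pulls the faces of [d] chosen by [h] back to [c]. *)
pose h' : symmetry := ((h.1 * g.1^-1)%g,
  [ffun j => h.2 j (+) g.2 ((g.1^-1)%g (h.1 j))]).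
have hE : compose g h' = h.
  rewrite [RHS]surjective_pairing /compose mulgKV; congr (_, _).
  by apply/ffunP => j; rewrite !ffunE permM addbK.
exists h'.
  by move: rot_h; rewrite -hE /rotation sym_mxM det_mulmx (eqP rot_g) mul1r.
clearbody h'; rewrite !cornerE; apply: eq_mkseq => j.
by rewrite -(eqP (paint_g _)) -hE /sym_face /= ffunE permM.
Qed.

(* The outer faces of [p], two of them exchanged if needed for a direct frame,
   are the images of the coordinate axes under a rotation. *)
Definition cell_sym (p : cell) : symmetry :=
  let s := if positive (cell_faces p) then 1%g else tperm (inord 0) (inord 1) in
  (s, [ffun j => p (s j)]).

Lemma corner_faces_cell p :
  corner_faces (cell_sym p) = rectify (cell_faces p).
Proof.
rewrite /rectify /corner_faces /cell_sym; case: ifP => _;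
  rewrite /mkseq /= !ffunE.
  by rewrite !perm1.
by rewrite tpermL tpermR tpermD // -val_eqE /= !inordK.
Qed.

Lemma rotation_cell p : rotation (cell_sym p).
Proof.
rewrite rotationE corner_faces_cell /cell_faces /face_index /mkseq /=.
rewrite !inordK //.
by case: (p _) (p _) (p _) => [] [] [].
Qed.

(** Every face chosen by [cell_sym p] is an outer face of [p], so the solid dictates its color. *)
Lemma solid_corner a s p : solid a s ->
  corner (a p) (cell_sym p) = corner s (cell_sym p).
Proof.
by move=> sol; rewrite !cornerE; apply: eq_mkseq => j; rewrite ffunE sol.
Qed.

Lemma mem_corners c h : rotation h -> corner c h \in corners (code c).
Proof.
rewrite rotationE => rot_h; apply/mapP; exists (corner_faces h) => //.
rewrite mem_filter rot_h /=.
have face_lt f : face_index f \in iota 0 6.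
  by rewrite mem_iota /face_index; case: f => i [] /=; have := ltn_ord i; lia.
by apply: allpairs_f => //; apply: allpairs_f.
Qed.

Lemma code_perm c : code c \in permutations (iota 0 6).
Proof.
rewrite mem_permutations.
have code_uniq : uniq (code c).
  rewrite map_inj_in_uniq ?iota_uniq // => i j; rewrite !mem_iota /= => i6 j6.
  move/val_inj/(injectiveP _ (valP c)) => [/(congr1 val)] /=.
  rewrite !inordK; lia.
have code_sub : {subset code c <= iota 0 6}.
  by move=> _ /mapP[k _ ->]; rewrite mem_iota /= ltn_ord.
apply: uniq_perm => //.
by have [] := uniq_min_size code_uniq code_sub isT.
Qed.

Lemma code_surj l : perm_eq l (iota 0 6) -> {c | code c == l}.
Proof.
move=> l_perm; have l_size : size l = 6 by rewrite (perm_size l_perm) size_iota.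
have l_uniq : uniq l by rewrite (perm_uniq l_perm) iota_uniq.
pose c := [ffun f : face => inord (nth 0 l (face_index f)) : color].
have face_lt f : face_index f < 6.
  by rewrite /face_index; case: f => i [] /=; have := ltn_ord i; lia.
have cE f : c f = nth 0 l (face_index f) :> nat.
  rewrite ffunE inordK //.
  have : nth 0 l (face_index f) \in l by rewrite mem_nth ?l_size.
  by rewrite (perm_mem l_perm) mem_iota.
have c_inj : injectiveb c.
  apply/injectiveP => f1 f2 /(congr1 val) /=; rewrite !cE => /eqP.
  rewrite nth_uniq ?l_size //; case: f1 f2 => [i a] [j b].
  rewrite /face_index /= => /eqP ij.
  move: (congr1 half ij) (congr1 odd ij).
  by rewrite !half_bit_double !oddD !odd_double !addbF !oddb => /val_inj -> ->.
exists (Sub c c_inj); apply/eqP/(@eq_from_nth _ 0).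
  by rewrite size_mkseq l_size.
rewrite size_mkseq => k k6; rewrite nth_mkseq // /paint SubK cE /face_index /=.
rewrite inordK ?odd_double_half //; lia.
Qed.

Lemma cells_sub : {subset cells <= [seq cell_faces p | p : cell]}.
Proof.
move=> _ /allpairsPdep[x [_ [x_in /allpairsPdep[y [z [y_in z_in ->]]] ->]]].
apply/mapP; exists [ffun i : 'I_3 => nth false [:: odd x; odd y; odd z] i].
  by rewrite mem_enum.
rewrite /cell_faces /face_index /mkseq /= !ffunE !inordK //=.
move: x_in y_in z_in; rewrite !inE.
by move=> /orP[] /eqP -> /orP[] /eqP -> /orP[] /eqP ->.
Qed.

(** Bounded multiplicities make [s] a permutation of a subsequence of [t]. *)
Lemma leq_count_of_count_mem (T : eqType) (P : pred T) (s t : seq T) :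
  (forall x, count_mem x s <= count_mem x t) -> count P s <= count P t.
Proof.
case/count_subseqP => u sub_ut perm_su.
by rewrite (seq.permP perm_su) leq_count_subseq.
Qed.

Lemma exists_codes (ls : seq (seq nat)) :
  all (perm_eq^~ (iota 0 6)) ls -> exists cs, map code cs = ls.
Proof.
elim: ls => [|l ls IH] /=; first by exists [::].
case/andP=> /code_surj[c /eqP c_l] /IH[cs cs_ls].
by exists (c :: cs); rewrite /= c_l cs_ls.
Qed.

Theorem theorem2 : exists I : {mset cube}%mset, size I = 23 /\ infeasible I.
Proof.
have [cs csE] := @exists_codes stock isT.
exists (seq_mset cs); split.
  by rewrite (perm_size (perm_eq_seq_mset cs)) -(size_map code) csE.
move=> v _ [b [a [s [le_b_cs same_ba sol _]]]].
have b_stock p : code (b p) \in stock.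
  rewrite -csE map_f // -(perm_mem (perm_eq_seq_mset cs)).
  apply: (msubset_subset le_b_cs).
  by rewrite (perm_mem (perm_eq_seq_mset _)) map_f ?mem_enum.
(* Here [w] is in short supply for [s]; the contradiction is that each cell asking for a corner of
   [w] uses up a copy of [w]. *)
have /hasP[w] := allP stock_shortage _ (code_perm s).
rewrite mem_undup => w_stock; apply/negP; rewrite -leqNgt -csE count_map.
have le_count x : count_mem x [seq b p | p : cell] <= count_mem x cs.
  by have /msubsetP/(_ x) := le_b_cs; rewrite !mset_seqE.
apply: leq_trans (leq_count_of_count_mem _ le_count).
(* The lists counted by [supply] are distinct, so they come from distinct cells. *)
have le_cells := leq_uniq_count (isT : uniq cells) cells_sub.
apply: leq_trans (leq_count_of_count_mem _ le_cells) _; rewrite !count_map.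
(* The cube in [p] has a corner of [w], so by disjointness its code is [w]. *)
apply: sub_count => p /= w_p; apply/eqP.
have [h rot_h b_h] := same_variety_corner (same_ba p) (rotation_cell p).
apply: (corners_disjoint (b_stock p) w_stock _ w_p).
rewrite -corner_faces_cell -/(corner s _) -(solid_corner p sol) -b_h.
exact: mem_corners.
Qed.
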